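(* Let $n>1$ and let $(x_j)_{j\ge1}$ be a sequence with values in $\{a_1,a_2,\dots,a_n\}\subseteq K_n$. Set \[ M=\{i\in[n]\mid x_k=a_i\text{ for some }k\ge1\},\qquad N=\{i\in[n]\mid x_k=a_i\text{ for infinitely many }k\ge1\}, \] and let $s_j=x_1x_2\cdots x_j$ for $j\ge1$. Assume that $N=M$. Then there exists $m_0\in\mathbb{N}$ such that $s_m=e_M$ for all $m\ge m_0$.
   Context: $[n]=\{1,\dots,n\}$. Kiselman's semigroup $K_n$ is the monoid, with unit element $e$, given by generators $a_1,\dots,a_n$ and relations $a_i^2=a_i$ for all $i\in[n]$, and $a_i a_j a_i = a_j a_i a_j = a_i a_j$ for all $1\le j<i\le n$. For $X\subseteq[n]$, write $X=\{i_1>i_2>\dots>i_k\}$ and set $e_X=a_{i_1}a_{i_2}\cdots a_{i_k}$, with $e_\emptyset=e$. *)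

(* Defs.v *)
From HB Require Import structures.
From mathcomp Require Import all_boot.
From mathcomp Require Import boolp classical_sets cardinality.

Set Implicit Arguments.
Unset Strict Implicit.
Unset Printing Implicit Defensive.

Local Open Scope nat_scope.
Local Open Scope quotient_scope.

(* The free monoid on a_1, ..., a_n is [seq 'I_n]; the ordinal [i : 'I_n]
   stands for the index i + 1 of [n] = {1, ..., n}, which preserves the order. *)

(* The least congruence on words containing the defining relations. *)
Inductive kiselman_cong (n : nat) : seq 'I_n -> seq 'I_n -> Prop :=
| kc_idem (i : 'I_n) : kiselman_cong [:: i; i] [:: i]
| kc_iji (i j : 'I_n) : j < i -> kiselman_cong [:: i; j; i] [:: i; j]
| kc_jij (i j : 'I_n) : j < i -> kiselman_cong [:: j; i; j] [:: i; j]
| kc_refl u : kiselman_cong u u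
| kc_sym u v : kiselman_cong u v -> kiselman_cong v u
| kc_trans v u w :
    kiselman_cong u v -> kiselman_cong v w -> kiselman_cong u w
| kc_cat u u' v v' :
    kiselman_cong u u' -> kiselman_cong v v' ->
    kiselman_cong (u ++ v) (u' ++ v').

Definition kiselman_rel (n : nat) : rel (seq 'I_n) :=
  fun u v => `[< kiselman_cong u v >].

Lemma kiselman_rel_refl n : reflexive (@kiselman_rel n).
Proof. by move=> u; apply/asboolP; apply: kc_refl. Qed.

Lemma kiselman_rel_sym n : symmetric (@kiselman_rel n).
Proof. by move=> u v; apply/asboolP/asboolP; apply: kc_sym. Qed.

Lemma kiselman_rel_trans n : transitive (@kiselman_rel n).
Proof.
by move=> v u w /asboolP uv /asboolP vw; apply/asboolP; apply: kc_trans uv vw.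
Qed.

Canonical kiselman_equiv (n : nat) : equiv_rel (seq 'I_n) :=
  EquivRel (@kiselman_rel n) (@kiselman_rel_refl n) (@kiselman_rel_sym n)
    (@kiselman_rel_trans n).

Definition kiselman (n : nat) : Type := {eq_quot (@kiselman_equiv n)}.

HB.instance Definition _ (n : nat) := Choice.on (kiselman n).
HB.instance Definition _ (n : nat) := EqQuotient.on (kiselman n).

Definition kclass (n : nat) (u : seq 'I_n) : kiselman n := \pi_(kiselman n) u.

Lemma kclassP n (u v : seq 'I_n) : kclass u = kclass v <-> kiselman_cong u v.
Proof.
split=> [/eqP | uv]; first by rewrite /kclass piE => /asboolP.
by apply/eqP; rewrite /kclass piE; apply/asboolP.
Qed.

Lemma kclass_repr n (x : kiselman n) : kclass (repr x) = x.
Proof. exact: reprK. Qed.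

Definition kone (n : nat) : kiselman n := kclass [::].

Definition kmul (n : nat) (x y : kiselman n) : kiselman n :=
  kclass (repr x ++ repr y).

Lemma kmulE n (u v : seq 'I_n) : kmul (kclass u) (kclass v) = kclass (u ++ v).
Proof.
by apply/kclassP; apply: kc_cat; apply/kclassP; rewrite kclass_repr.
Qed.

Lemma kmulA n : associative (@kmul n).
Proof.
move=> x y z.
by rewrite -[x]kclass_repr -[y]kclass_repr -[z]kclass_repr !kmulE catA.
Qed.

Lemma kmul1x n : left_id (kone n) (@kmul n).
Proof. by move=> x; rewrite -[x]kclass_repr kmulE. Qed.

Lemma kmulx1 n : right_id (kone n) (@kmul n).
Proof. by move=> x; rewrite -[x]kclass_repr kmulE cats0. Qed.

HB.instance Definition _ (n : nat) :=
  isMonoid.Build (kiselman n) (@kmulA n) (@kmul1x n) (@kmulx1 n).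

Definition kgen (n : nat) (i : 'I_n) : kiselman n := kclass [:: i].

Lemma kclassM n (u v : seq 'I_n) :
  (kclass u * kclass v = kclass (u ++ v))%g.
Proof. exact: kmulE. Qed.

Lemma kgen_idem n (i : 'I_n) : (kgen i * kgen i = kgen i)%g.
Proof. by rewrite /kgen kclassM; apply/kclassP; apply: kc_idem. Qed.

Lemma kgen_iji n (i j : 'I_n) :
  j < i -> (kgen i * kgen j * kgen i = kgen i * kgen j)%g.
Proof. by move=> ji; rewrite /kgen !kclassM; apply/kclassP; apply: kc_iji. Qed.

Lemma kgen_jij n (i j : 'I_n) :
  j < i -> (kgen j * kgen i * kgen j = kgen i * kgen j)%g.
Proof. by move=> ji; rewrite /kgen !kclassM; apply/kclassP; apply: kc_jij. Qed.

Definition kdec (n : nat) (X : {set 'I_n}) : kiselman n :=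
  (\prod_(i <- sort (fun i j : 'I_n => j <= i) (enum X)) kgen i)%g.

(* Sequences (x_j), j >= 1, are functions on nat whose value at 0 is ignored. *)

Definition occurring (n : nat) (x : nat -> kiselman n) : {set 'I_n} :=
  [set i : 'I_n | `[< exists k, 0 < k /\ x k = kgen i >]]%SET.

Definition occurring_infinitely (n : nat) (x : nat -> kiselman n) :
    {set 'I_n} :=
  [set i : 'I_n |
    `[< infinite_set [set k | 0 < k /\ x k = kgen i]%classic >]]%SET.

Definition partial_prod (n : nat) (x : nat -> kiselman n) (m : nat) :
    kiselman n :=
  (\prod_(1 <= k < m.+1) x k)%g.

(* Main.v *)
Require Import Defs.
From mathcomp Require Import all_boot.
From mathcomp Require Import boolp classical_sets cardinality.

(** The word [e_M] absorbs every letter of [M] on the right, so it suffices to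
    reach [e_M] once.  Any word [w] over [M] that contains [e_M] as a
    subsequence already represents [e_M]: if [j] is the least letter of [M],
    then in a word over [M] that ends with [j] all earlier occurrences of [j]
    can be erased; cutting [w] at an occurrence of [j] that follows the rest of
    [e_M] and erasing the earlier ones leaves a word over [M \ {j}], to which
    induction applies.  As every letter of [M] recurs, some [s_m] contains
    [e_M] as a subsequence. *)

Set Implicit Arguments.
Unset Strict Implicit.
Unset Printing Implicit Defensive.

Local Open Scope nat_scope.

Definition kword (n : nat) (w : seq 'I_n) : kiselman n :=
  (\prod_(i <- w) kgen i)%g.

Lemma kword_cat n (u v : seq 'I_n) : kword (u ++ v) = (kword u * kword v)%g.
Proof. exact: big_cat. Qed.

Lemma kword_cons n (i : 'I_n) w : kword (i :: w) = (kgen i * kword w)%g.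
Proof. exact: big_cons. Qed.

Lemma kword1 n (i : 'I_n) : kword [:: i] = kgen i.
Proof. exact: big_seq1. Qed.

Lemma kword_rcons n (i : 'I_n) w : kword (rcons w i) = (kword w * kgen i)%g.
Proof. by rewrite -cats1 kword_cat kword1. Qed.

(** Induction from the right: the hypothesis inserts a copy of [i] just before the last letter [l],
    and $a_i a_l a_i = a_i a_l$ then removes the final [i]. *)
Lemma kgen_absorb_right n (i : 'I_n) u :
  all (fun l : 'I_n => l <= i) u ->
  (kgen i * kword u * kgen i = kgen i * kword u)%g.
Proof.
elim/last_ind: u => [_|u l IHu]; first by rewrite /kword big_nil mulg1 kgen_idem.
rewrite all_rcons => /andP[li /IHu {}IHu].
have ili : (kgen i * kgen l * kgen i = kgen i * kgen l)%g.
  move: li; rewrite leq_eqVlt => /orP[/eqP/val_inj ->|]; last exact: kgen_iji.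
  by rewrite !kgen_idem.
by rewrite kword_rcons mulgA -IHu -!mulgA (mulgA (kgen i) (kgen l)) ili.
Qed.

(** Mirror argument: a copy of [j] is inserted just after the first letter [l], and $a_j a_l a_j =
    a_l a_j$ removes the leading [j]. *)
Lemma kgen_absorb_left n (j : 'I_n) u :
  all (fun l : 'I_n => j <= l) u ->
  (kgen j * (kword u * kgen j) = kword u * kgen j)%g.
Proof.
elim: u => [_|l u IHu] /=; first by rewrite /kword big_nil mul1g kgen_idem.
move=> /andP[jl /IHu {}IHu].
have jlj : (kgen j * kgen l * kgen j = kgen l * kgen j)%g.
  move: jl; rewrite leq_eqVlt => /orP[/eqP/val_inj <-|]; last exact: kgen_jij.
  by rewrite !kgen_idem.
by rewrite kword_cons -mulgA -IHu !mulgA jlj.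
Qed.

Lemma kword_erase_min n (j : 'I_n) w :
  all (fun l : 'I_n => j <= l) w ->
  (kword w * kgen j = kword (filter (predC1 j) w) * kgen j)%g.
Proof.
elim: w => //= l w IHw /andP[jl jw]; case: eqVneq => [->|_] /=.
  by rewrite kword_cons -mulgA kgen_absorb_left // IHw.
by rewrite !kword_cons -!mulgA IHw.
Qed.

(** Stated pairwise, so that splitting [s] at a letter compares that letter with all the others at
    once. *)
Definition decreasing n (s : seq 'I_n) := pairwise (fun i j : 'I_n => j < i) s.

(** Each letter [i] of [w] occurs in [s] and is followed there only by smaller letters, so that
    occurrence absorbs it. *)
Lemma decreasing_absorb n (s w : seq 'I_n) :
  decreasing s -> {subset w <= s} -> (kword s * kword w = kword s)%g.
Proof.
move=> ds; elim: w => [|i w IHw] sub; first by rewrite /kword big_nil mulg1.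
have /path.splitPr def_s : i \in s by apply: sub; exact: mem_head.
rewrite kword_cons mulgA; suff -> : (kword s * kgen i = kword s)%g.
  by apply: IHw => l lw; apply: sub; rewrite inE lw orbT.
case: def_s ds => s1 s2; rewrite /decreasing pairwise_cat /=.
move=> /and3P[_ _ /andP[lt_s2 _]].
rewrite kword_cat kword_cons -!mulgA (mulgA (kgen i)) kgen_absorb_right //.
by apply: sub_all lt_s2 => l /ltnW.
Qed.

Lemma subseq_rcons_split (T : eqType) (s w : seq T) (j : T) :
  subseq (rcons s j) w ->
  exists w1 w2, w = w1 ++ j :: w2 /\ subseq s w1.
Proof.
elim: w s => [|a w IHw] [|b s] //=.
- case: eqVneq => [-> _|_ /(IHw [::])[w1 [w2 [-> _]]]].
    by exists [::], w.
  by exists (a :: w1), w2.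
- case: eqVneq => [->|neq] => [/IHw|/(IHw (b :: s))] [w1 [w2 [-> sw1]]].
    by exists (a :: w1), w2; rewrite /= eqxx.
  by exists (a :: w1), w2; rewrite /= (negbTE neq).
Qed.

Lemma kword_subseq n (s w : seq 'I_n) :
  decreasing s -> {subset w <= s} -> subseq s w -> kword w = kword s.
Proof.
elim/last_ind: s w => [|s j IHs] w ds sub.
  by case: w sub => // a w /(_ a (mem_head _ _)).
move=> /subseq_rcons_split[w1 [w2 [def_w sw1]]].
have [s_gt_j ds'] : all (fun l : 'I_n => j < l) s /\ decreasing s.
  by move: ds; rewrite /decreasing pairwise_rcons => /andP[].
have w1_ge_j : all (fun l : 'I_n => j <= l) w1.
  apply/allP => l lw1; have : l \in rcons s j.
    by apply: sub; rewrite def_w mem_cat lw1.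
  by rewrite mem_rcons inE => /predU1P[->//|/(allP s_gt_j)/ltnW].
(* Erasing [j] from [w1] keeps [s] as a subsequence, since all letters of [s] exceed [j]. *)
have {}IHs : kword (filter (predC1 j) w1) = kword s.
  apply: IHs => // [l|].
    rewrite mem_filter /= => /andP[lj lw1].
    have : l \in rcons s j by apply: sub; rewrite def_w mem_cat lw1.
    by rewrite mem_rcons inE (negbTE lj).
  rewrite subseq_filter sw1 andbT; apply/allP => l /(allP s_gt_j) /=.
  by case: eqVneq => // ->; rewrite ltnn.
rewrite def_w kword_cat kword_cons mulgA kword_erase_min // IHs.
(* The part [w2] after the cut is absorbed by the word [rcons s j] already formed. *)
rewrite -kword_rcons decreasing_absorb // => l lw2; apply: sub.
by rewrite def_w mem_cat inE lw2 !orbT.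
Qed.

(** Serves twice: to advance to the next occurrence of a wanted letter, and to express the tail that
    $e_M$ absorbs. *)
Lemma partial_prod_extend n (x : nat -> kiselman n) (m k : nat) :
  (forall k, 0 < k -> exists i : 'I_n, x k = kgen i) -> m <= k ->
  exists u : seq 'I_n, {subset u <= occurring x} /\
    partial_prod x k = (partial_prod x m * kword u)%g.
Proof.
move=> hx /subnK <-; elim: (k - m) => [|d [u [sub IHd]]].
  by exists [::]; rewrite /kword big_nil mulg1.
have [i xi] := hx (d + m).+1 isT; exists (rcons u i); split.
  move=> l; rewrite mem_rcons inE => /predU1P[->|/sub//].
  by rewrite inE; apply/asboolP; exists (d + m).+1.
by rewrite addSn /partial_prod big_nat_recr //= -/(partial_prod x _) IHd
  xi kword_rcons mulgA.
Qed.

(** Otherwise [A] lies in the finite set of numbers below [m.+1]. *)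
Lemma infinite_set_gt (A : set nat) (m : nat) :
  infinite_set A -> exists2 k, m < k & A k.
Proof.
move=> infA; apply: contrapT => noA; apply: infA.
apply: (@sub_finite_set _ _ `I_m.+1); last exact: finite_II.
by move=> k Ak /=; rewrite ltnS leqNgt; apply/negP => mk; apply: noA; exists k.
Qed.

Lemma partial_prod_subseq n (x : nat -> kiselman n) (s : seq 'I_n) :
  (forall k, 0 < k -> exists i : 'I_n, x k = kgen i) ->
  occurring_infinitely x = occurring x -> {subset s <= occurring x} ->
  exists m (w : seq 'I_n), [/\ {subset w <= occurring x}, subseq s w &
    partial_prod x m = kword w].
Proof.
move=> hx hNM; elim/last_ind: s => [_|s j IHs sub].
  by exists 0, [::]; split=> //; rewrite /partial_prod /kword big_geq // big_nil.
have [|m [w [subw sw eqw]]] := IHs.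
  by move=> l ls; apply: sub; rewrite mem_rcons inE ls orbT.
have jM : j \in occurring x by apply: sub; rewrite mem_rcons mem_head.
have jN : j \in occurring_infinitely x by rewrite hNM.
(* The letter [j] recurs at some index [k.+1] beyond [m], hence after the copy of [s] found so
   far. *)
move: jN; rewrite inE => /asboolP /(infinite_set_gt m)[[//|k] mk [_ xk]].
have [u [subu equ]] := partial_prod_extend hx (ltnSE mk).
exists k.+1, (rcons (w ++ u) j); split.
- move=> l; rewrite mem_rcons inE mem_cat.
  by case/predU1P => [->//|/orP[/subw|/subu]].
- by rewrite -!cats1 cat_subseq // (subseq_trans sw) // prefix_subseq.
by rewrite /partial_prod big_nat_recr //= -/(partial_prod x k) equ eqw xk
  kword_rcons kword_cat.
Qed.

Lemma decreasing_sort_enum n (X : {set 'I_n}) :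
  decreasing (sort (fun i j : 'I_n => j <= i) (enum X)).
Proof.
set s := sort _ _.
(* Sorting gives only a weak order; it is strict because [enum X] has no duplicates. *)
have : sorted gtn (map val s).
  rewrite gtn_sorted_uniq_geq map_inj_uniq; last exact: val_inj.
  rewrite sort_uniq enum_uniq sorted_map.
  by apply: sort_sorted => i j; exact: leq_total.
rewrite sorted_pairwise ?pairwise_map //.
by move=> b a c ab bc; exact: ltn_trans bc ab.
Qed.

Theorem theorem6p2 (n : nat) (hn : 1 < n) (x : nat -> kiselman n)
    (hx : forall k : nat, 0 < k -> exists i : 'I_n, x k = kgen i)
    (hNM : occurring_infinitely x = occurring x) :
  exists m0 : nat, forall m : nat, m0 <= m ->
    partial_prod x m = kdec (occurring x).
Proof.
set s := sort (fun i j : 'I_n => j <= i) (enum (occurring x)).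
have ds : decreasing s := decreasing_sort_enum _.
have mem_s : s =i occurring x by move=> i; rewrite mem_sort mem_enum.
have [|m0 [w [subw sw eqw]]] := @partial_prod_subseq n x s hx hNM.
  by move=> i; rewrite mem_s.
(* From [m0] on, the product is $e_M$ times a word over $M$. *)
exists m0 => m /(partial_prod_extend hx)[u [subu ->]].
rewrite eqw (kword_subseq ds) // => [|i /subw]; last by rewrite mem_s.
by rewrite (decreasing_absorb ds) // => i /subu; rewrite mem_s.
Qed.
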